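(* Let $n,m\in\mathbb{N}$ with $m<n$, let $A=(a_{ij})$ be a real $m\times n$ matrix of rank $m$, and let $b\in\mathbb{R}^m$. Define $$C=\{(x,w,y)\in\mathbb{R}^n\times\mathbb{R}^n\times\mathbb{R} \;:\; Ax=b \text{ and } w_j=x_jy \text{ for all } j\in\{1,\ldots,n\}\},$$ and for each subset $J\subseteq\{1,\ldots,n\}$ define $$R_J=\{(x,w,y)\in\mathbb{R}^n\times\mathbb{R}^n\times\mathbb{R} \;:\; Ax=b,\ Aw-by=0, \text{ and } w_j=x_jy \text{ for all } j\in J\}.$$ Then there exists a subset $J\subseteq\{1,\ldots,n\}$ with $|J|=n-m$ such that $C=R_J$.
   Context: For $b=(b_1,\ldots,b_m)^T\in\mathbb{R}^m$ and a scalar $y\in\mathbb{R}$, $by$ denotes the vector $(b_1y,\ldots,b_my)^T\in\mathbb{R}^m$. Here $x=(x_1,\ldots,x_n)^T$ and $w=(w_1,\ldots,w_n)^T$ are vectors in $\mathbb{R}^n$. *)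

(* Defs.v *)
From mathcomp Require Import all_boot all_order all_algebra.
From mathcomp Require Import classical_sets reals.

Set Implicit Arguments.
Unset Strict Implicit.
Unset Printing Implicit Defensive.

Import GRing.Theory Num.Theory.
Local Open Scope classical_set_scope.
Local Open Scope ring_scope.

(* Points of R^n x R^n x R are triples (x, w, y) with x and w column vectors. *)

Definition bilinear_set (R : realType) (m n : nat) (A : 'M[R]_(m, n))
    (b : 'cV[R]_m) : set ('cV[R]_n * 'cV[R]_n * R) :=
  [set p : 'cV[R]_n * 'cV[R]_n * R | let: (x, w, y) := p in
           A *m x = b /\ forall j : 'I_n, w j 0 = x j 0 * y].

(* The vector "by" is written y *: b, the scaling of b by y. *)
Definition reduced_set (R : realType) (m n : nat) (A : 'M[R]_(m, n))
    (b : 'cV[R]_m) (J : {set 'I_n}) : set ('cV[R]_n * 'cV[R]_n * R) :=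
  [set p : 'cV[R]_n * 'cV[R]_n * R | let: (x, w, y) := p in
           [/\ A *m x = b, A *m w - y *: b = 0
             & forall j : 'I_n, j \in J -> w j 0 = x j 0 * y]].

(* Main.v *)
(** Put [v = w - y x].  Given [A x = b], the condition [A w - b y = 0] says
    exactly that [A v = 0], and [w_j = x_j y] says that [v_j = 0].  Choose [m]
    columns of [A] forming an invertible matrix and let [J] be the complementary
    indices: if [v] vanishes on [J], then [A v = 0] is an invertible linear system
    in the remaining entries of [v], so [v = 0]. *)
Require Import Defs.
From mathcomp Require Import all_boot all_order all_algebra.
From mathcomp Require Import classical_sets reals.

Local Open Scope ring_scope.

Import GRing.Theory.

(** Since [A^T] has full column rank [m], some [m] of its rows form an invertible matrix;
    transposing turns them into columns of [A]. *)
Lemma exists_colsub_unit (F : fieldType) (m n : nat) (A : 'M[F]_(m, n)) :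
  \rank A = m ->
  exists2 f : 'I_m -> 'I_n, injective f & colsub f A \in unitmx.
Proof.
move=> rA; have fA : row_full A^T by rewrite /row_full mxrank_tr rA.
exists (fullrankfun fA); first exact: fullrankfun_inj.
by rewrite -unitmx_tr trmx_mxsub fullrowsub_unit.
Qed.

(** In each entry of the product, the terms indexed outside the image of [f] vanish. *)
Lemma mulmx_colsub_rowsub (S : pzSemiRingType) (m n p k : nat)
    (A : 'M[S]_(m, n)) (B : 'M[S]_(n, p)) (f : 'I_k -> 'I_n) :
  injective f -> (forall i, i \notin codom f -> row i B = 0) ->
  A *m B = colsub f A *m rowsub f B.
Proof.
move=> injf B0; apply/matrixP => i j; rewrite !mxE.
rewrite (bigID (mem (codom f))) /= [X in _ + X]big1 ?addr0; last first.
  by move=> l /B0/rowP/(_ j); rewrite !mxE => ->; rewrite mulr0.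
(* Injectivity of [f] makes each index of the image occur once in [codom f], so the remaining sum
   can be reindexed over ['I_k]. *)
have Uf : uniq (codom f) by rewrite map_inj_uniq ?enum_uniq.
rewrite -(big_uniq _ Uf).
by rewrite big_image; apply: eq_bigr => l _; rewrite !mxE.
Qed.

Lemma ker_eq0_off_unit_colsub (F : fieldType) (m n : nat) (A : 'M[F]_(m, n))
    (f : 'I_m -> 'I_n) (v : 'cV[F]_n) :
  injective f -> colsub f A \in unitmx -> A *m v = 0 ->
  (forall j, j \notin codom f -> v j 0 = 0) -> v = 0.
Proof.
move=> injf unitA Av0 v0.
have vrow0 i : i \notin codom f -> row i v = 0.
  by move=> /v0 vi0; apply/rowP => j; rewrite ord1 !mxE.
have fv0 : rowsub f v = 0.
  (* Cancel the invertible block: it suffices that [colsub f A] kills [rowsub f v], and that product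
     is [A *m v]. *)
  apply: (can_inj (mulKmx unitA)).
  by rewrite -mulmx_colsub_rowsub // Av0 mulmx0.
apply/colP => j; rewrite mxE; have [/codomP[i ->]|/v0 //] := boolP (j \in codom f).
by move/colP/(_ i): fv0; rewrite !mxE.
Qed.

Theorem mainTheorem1 (R : realType) (n m : nat) (A : 'M[R]_(m, n))
    (b : 'cV[R]_m) :
  (m < n)%N -> \rank A = m ->
  exists J : {set 'I_n},
    #|J| = (n - m)%N /\ bilinear_set A b = reduced_set A b J.
Proof.
move=> _ /exists_colsub_unit[f injf unitA].
exists (~: [set j in codom f]); split.
  by rewrite cardsCs finset.setCK cardsE card_codom // !card_ord.
apply/seteqP; split=> -[[x w] y] /= [Ax].
  move=> wxy; split=> //.
  have -> : w = y *: x by apply/colP => j; rewrite mxE wxy mulrC.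
  by rewrite -scalemxAr Ax subrr.
move=> Aw wxy; split=> // j.
suff /eqP : w - y *: x = 0 by rewrite subr_eq0 => /eqP ->; rewrite mxE mulrC.
apply: (ker_eq0_off_unit_colsub _ _ _ A f) => //.
  by rewrite mulmxBr -scalemxAr Ax.
by move=> i fi; rewrite !mxE wxy ?inE // mulrC subrr.
Qed.
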